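(* Let $\alpha,\xi,\gamma,\alpha',\xi',\gamma'\in\mathbb{K}^*$. Every simple right $A_2^{\underline{q},\Lambda}$-module of type $(M_5,\alpha,\xi,\gamma)$ has $\mathbb{K}$-dimension $l_1$. Furthermore, simple modules of types $(M_5,\alpha,\xi,\gamma)$ and $(M_5,\alpha',\xi',\gamma')$ are isomorphic if and only if $\alpha=\alpha'$, $\xi=(q_1\lambda)^r\xi'$ and $\gamma=q_1^r\gamma'$ for some $0\le r\le l_1-1$.
   Context: $\mathbb{K}$ is an algebraically closed field of arbitrary characteristic. $q_1,q_2\in\mathbb{K}\setminus\{0,1\}$ and $\lambda\in\mathbb{K}^*$, where $q_i$ is a primitive $l_i$-th root of unity ($i=1,2$) and $\lambda^{l_1}=1$. All modules are right modules. $A_2^{\underline{q},\Lambda}$ is the unital associative $\mathbb{K}$-algebra generated by $x_1,y_1,x_2,y_2$ subject to $$x_1x_2=q_1\lambda x_2x_1,\quad x_1y_2=\lambda^{-1}y_2x_1,\quad y_1y_2=\lambda y_2y_1,\quad y_1x_2=q_1^{-1}\lambda^{-1}x_2y_1,$$ $$x_1y_1-q_1y_1x_1=1,\qquad x_2y_2-q_2y_2x_2=1+(q_1-1)y_1x_1.$$ Put $z_i=x_iy_i-y_ix_i$ for $i=1,2$; these are normal elements, so each acts on a simple module either as zero or invertibly. The elements $x_1^{l_1},y_1^{l_1},x_2,z_1$ commute with each other, and $x_1^{l_1},y_1^{l_1}$ are central. A simple module of type $(M_5,\alpha,\xi,\gamma)$ is a simple right $A_2^{\underline{q},\Lambda}$-module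 $M$ on which $z_1$ acts invertibly and $z_2$ acts as zero, and which contains a nonzero common eigenvector $v$ of $x_1^{l_1},y_1^{l_1},x_2,z_1$ such that $$vx_1^{l_1}=\alpha v,\quad vx_2=\xi v,\quad vz_1=\gamma v$$ with $\alpha,\xi,\gamma$ nonzero (and $vy_1^{l_1}=\beta v$ for some $\beta\in\mathbb{K}$). Such an $M$ is denoted $(M_5,\alpha,\xi,\gamma)$. *)

(* Defs.v *)
From HB Require Import structures.
From mathcomp Require Import all_boot all_order all_algebra.
From mathcomp Require Import generic_quotient ring_quotient.
From mathcomp Require Import boolp.
From mathcomp Require Import monalg.

Set Implicit Arguments.
Unset Strict Implicit.
Unset Printing Implicit Defensive.

Import GRing.Theory.
Local Open Scope ring_scope.
Local Open Scope quotient_scope.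

(* The free unital associative algebra K<X_0, ..., X_(n-1)>: the monoid
   algebra of the free monoid of words in n letters. *)
Section FreeAlgebra.
Variables (K : fieldType) (n : nat).

Definition freealg : Type := {malg K[{fmonom 'I_n}]}.
HB.instance Definition _ := GRing.Lalgebra.on freealg.

Lemma freealg_scalerAr (c : K) (f g : freealg) : c *: (f * g) = f * (c *: g).
Proof.
have cC (h : {malg K[{fmonom 'I_n}]}) : h * mkmalgU mone c = c *: h.
  rewrite malgM_def fgmulgU malgZ_def /fgscale.
  by apply: eq_bigr => k _; rewrite mulm1 mulrC.
rewrite -(mul_malgC c g) -(mul_malgC c (f * g)) !mulrA.
by rewrite (cC f) (mul_malgC c f).
Qed.

HB.instance Definition _ :=
  GRing.Lalgebra_isAlgebra.Build K freealg freealg_scalerAr.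

End FreeAlgebra.

Definition fvar (K : fieldType) (n : nat) (i : 'I_n) : freealg K n :=
  mkmalgU (fmu i) 1.

Lemma freealg_ind (K : fieldType) (n : nat) (P : freealg K n -> Prop) :
  P 1 -> (forall f g, P f -> P g -> P (f + g)) ->
  (forall c f, P f -> P (c *: f)) -> (forall i f, P f -> P (fvar K i * f)) ->
  forall f, P f.
Proof.
move=> P1 PD PZ PM f.
have P0 : P 0 by rewrite -(scale0r (1 : freealg K n)); apply: PZ.
have Pw (w : seq 'I_n) : P (mkmalgU (FMonom w) 1).
  elim: w => [|i w IHw]; first by rewrite -fmoneE.
  have -> : FMonom (i :: w) = mmul (fmu i) (FMonom w).
    by apply: val_inj; rewrite /= fmM fmuE.
  have -> : mkmalgU (mmul (fmu i) (FMonom w)) 1 =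
      (fvar K i : freealg K n) * mkmalgU (FMonom w) 1.
    by rewrite [RHS]malgM_def fgmulUU mul1r.
  exact: PM.
rewrite [f]monalgE; elim/big_ind: _ => // k _.
have -> : mkmalgU k (mcoeff k f) = mcoeff k f *: (mkmalgU k 1 : {malg K[_]}).
  by rewrite -[RHS]mul_malgC malgM_def fgmulUU mulr1 mul1m.
by case: k => w; apply: PZ.
Qed.

(* The algebra presented by the relators in rels, i.e. the quotient of F by
   the smallest two-sided ideal containing them.  It is only given a pzRingType
   structure (besides its K-module structure), since 1 = 0 is not excluded for
   arbitrary relators; this is why it is not declared as an algType. *)
Section Presentation.
Variables (K : fieldType) (F : algType K) (rels : seq F).

Definition two_sided_ideal (I : F -> Prop) : Prop :=
  [/\ I 0, forall x y, I x -> I y -> I (x - y)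
    & forall a x b, I x -> I (a * x * b)].

Definition rel_ideal : {pred F} := fun x =>
  `[< forall I, two_sided_ideal I -> (forall r, r \in rels -> I r) -> I x >].

Lemma rel_ideal_zmod_closed : zmod_closed rel_ideal.
Proof.
split=> [|x y /asboolP xI /asboolP yI]; apply/asboolP => I II rI.
  by case: II.
by have [_ IB _] := II; apply: IB; [exact: xI | exact: yI].
Qed.

HB.instance Definition _ :=
  GRing.isZmodClosed.Build F rel_ideal rel_ideal_zmod_closed.

Lemma rel_idealM a x b : x \in rel_ideal -> a * x * b \in rel_ideal.
Proof.
move=> /asboolP xI; apply/asboolP => I II rI.
by have [_ _ IM] := II; apply: IM; exact: xI.
Qed.

Lemma rel_ideal_gen r : r \in rels -> r \in rel_ideal.
Proof. by move=> rr; apply/asboolP => I _ rI; exact: rI. Qed.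

Definition palg : Type := Quotient.quot rel_ideal.
HB.instance Definition _ := GRing.Zmodule.on palg.
HB.instance Definition _ := EqQuotient.on palg.

Lemma palg_eqP (x y : F) : (\pi_palg x = \pi_palg y) <-> (x - y \in rel_ideal).
Proof. by rewrite (Quotient.idealrBE rel_ideal); split=> [->|/eqP]. Qed.

Lemma palg_piD : {morph \pi_palg : x y / x + y}.
Proof. exact: Quotient.pi_add. Qed.

Lemma palg_pi0 : \pi_palg 0 = 0.
Proof. by apply: (addrI (\pi_palg 0)); rewrite -palg_piD !addr0. Qed.

Lemma palg_piN : {morph \pi_palg : x / - x}.
Proof. exact: Quotient.pi_opp. Qed.

Lemma palg_gen r : r \in rels -> \pi_palg r = 0.
Proof.
by move=> rr; rewrite -palg_pi0; apply/palg_eqP; rewrite subr0 rel_ideal_gen.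
Qed.

Definition palg_one : palg := lift_cst palg 1.
Definition palg_mul := lift_op2 palg *%R.
Definition palg_scale (c : K) := lift_op1 palg ( *:%R c).

Lemma repr_sub (x : F) : repr (\pi_palg x) - x \in rel_ideal.
Proof. by apply/palg_eqP; rewrite reprK. Qed.

Lemma palg_piM : {morph \pi_palg : x y / x * y >-> palg_mul x y}.
Proof.
move=> x y; unlock palg_mul; apply/esym/palg_eqP.
set x' := repr _; set y' := repr _.
have -> : x' * y' - x * y = 1 * (x' - x) * y' + x * (y' - y) * 1.
  by rewrite mul1r mulr1 mulrBl mulrBr addrA subrK.
by rewrite rpredD // rel_idealM // repr_sub.
Qed.

Lemma palg_piZ (c : K) (x : F) : \pi_palg (c *: x) = palg_scale c (\pi_palg x).
Proof.
unlock palg_scale; apply/esym/palg_eqP; rewrite -scalerBr -mulr_algl -[_ * _]mulr1.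
by rewrite rel_idealM // repr_sub.
Qed.

Lemma palg_mulA : associative palg_mul.
Proof.
elim/quotW=> x; elim/quotW=> y; elim/quotW=> z.
by rewrite -!palg_piM mulrA.
Qed.

Lemma palg_pi1 : \pi_palg 1 = palg_one.
Proof. by rewrite /palg_one -lock. Qed.

Lemma palg_mul1 : left_id palg_one palg_mul.
Proof. by elim/quotW=> x; rewrite -palg_pi1 -!palg_piM mul1r. Qed.

Lemma palg_mulr1 : right_id palg_one palg_mul.
Proof. by elim/quotW=> x; rewrite -palg_pi1 -!palg_piM mulr1. Qed.

Lemma palg_mulDl : left_distributive palg_mul +%R.
Proof.
elim/quotW=> x; elim/quotW=> y; elim/quotW=> z.
by rewrite -palg_piD -!palg_piM -palg_piD mulrDl.
Qed.

Lemma palg_mulDr : right_distributive palg_mul +%R.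
Proof.
elim/quotW=> x; elim/quotW=> y; elim/quotW=> z.
by rewrite -palg_piD -!palg_piM -palg_piD mulrDr.
Qed.

HB.instance Definition _ := GRing.Zmodule_isPzRing.Build palg
  palg_mulA palg_mul1 palg_mulr1 palg_mulDl palg_mulDr.

Lemma palg_scaleA a b (x : palg) :
  palg_scale a (palg_scale b x) = palg_scale (a * b) x.
Proof. by elim/quotW: x => x; rewrite -!palg_piZ scalerA. Qed.

Lemma palg_scale1 : left_id 1 palg_scale.
Proof. by elim/quotW=> x; rewrite -palg_piZ scale1r. Qed.

Lemma palg_scaleDr : right_distributive palg_scale +%R.
Proof.
move=> c; elim/quotW=> x; elim/quotW=> y.
by rewrite -palg_piD -!palg_piZ -palg_piD scalerDr.
Qed.

Lemma palg_scaleDl x : {morph palg_scale^~ x : a b / a + b}.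
Proof.
by move=> a b; elim/quotW: x => x; rewrite -!palg_piZ -palg_piD scalerDl.
Qed.

HB.instance Definition _ := GRing.Zmodule_isLmodule.Build K palg
  palg_scaleA palg_scale1 palg_scaleDr palg_scaleDl.

Lemma palg_scalerAl (c : K) (x y : palg) : c *: (x * y) = (c *: x) * y.
Proof.
elim/quotW: x => x; elim/quotW: y => y; change (_ = _) with
  (palg_scale c (palg_mul (\pi_palg x) (\pi_palg y)) =
   palg_mul (palg_scale c (\pi_palg x)) (\pi_palg y)).
by rewrite -palg_piZ -!palg_piM -palg_piZ scalerAl.
Qed.

Lemma palg_scalerAr (c : K) (x y : palg) : c *: (x * y) = x * (c *: y).
Proof.
elim/quotW: x => x; elim/quotW: y => y; change (_ = _) with
  (palg_scale c (palg_mul (\pi_palg x) (\pi_palg y)) =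
   palg_mul (\pi_palg x) (palg_scale c (\pi_palg y))).
by rewrite -palg_piZ -!palg_piM -palg_piZ scalerAr.
Qed.

Lemma palg_scale1M (a b : K) :
  (a *: (1 : palg)) * (b *: (1 : palg)) = (a * b) *: (1 : palg).
Proof. by rewrite -palg_scalerAl mul1r scalerA. Qed.

End Presentation.

(* Right modules over a ring R are left modules over its converse ring. *)
Section RightModules.
Variable R : pzRingType.

Definition rmod := lmodType R^c.

Definition ract (M : rmod) (m : M) (a : R) : M := (a : R^c) *: m.

Lemma ractM (M : rmod) (m : M) a b : ract m (a * b) = ract (ract m a) b.
Proof. exact/esym/(@scalerA R^c M b a m). Qed.

Lemma ract1 (M : rmod) (m : M) : ract m 1 = m.
Proof. exact: (@scale1r R^c M m). Qed.

Lemma ractDl (M : rmod) a : {morph (@ract M)^~ a : m m' / m + m'}.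
Proof. exact: (@scalerDr R^c M a). Qed.

Lemma ractDr (M : rmod) (m : M) : {morph @ract M m : a b / a + b}.
Proof. by move=> a b; apply: (@scalerDl R^c M m a b). Qed.

Definition simple_rmod (M : rmod) : Prop :=
  (exists m : M, m != 0) /\
  (forall S : {pred M}, submod_closed S -> S =i pred1 0 \/ S =i predT).

Definition rmod_iso (M M' : rmod) : Prop :=
  exists f : {linear M -> M'}, bijective f.

End RightModules.

Notation "v '*r' a" := (ract v a) (at level 40, left associativity).

(* A right module over a K-algebra is a K-vector space, c acting as c *: 1. *)
Section RestrictionOfScalars.
Variables (K : fieldType) (F : algType K) (rels : seq F).
Variable M : rmod (palg rels).

Definition restr : Type := M.
HB.instance Definition _ := GRing.Zmodule.on restr.

Definition restr_scale (c : K) (m : restr) : restr :=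
  (m : M) *r (c *: (1 : palg rels)).

Lemma restr_scaleA a b m :
  restr_scale a (restr_scale b m) = restr_scale (a * b) m.
Proof. by rewrite /restr_scale mulrC -palg_scale1M ractM. Qed.

Lemma restr_scale1 : left_id 1 restr_scale.
Proof. by move=> m; rewrite /restr_scale scale1r ract1. Qed.

Lemma restr_scaleDr : right_distributive restr_scale +%R.
Proof. by move=> c m m'; apply: ractDl. Qed.

Lemma restr_scaleDl m : {morph restr_scale^~ m : a b / a + b}.
Proof. by move=> a b; rewrite /restr_scale scalerDl; apply: ractDr. Qed.

HB.instance Definition _ := GRing.Zmodule_isLmodule.Build K restr
  restr_scaleA restr_scale1 restr_scaleDr restr_scaleDl.

(* v is an eigenvector (or zero): v a = c v. *)
Definition eigen (v : M) (a : palg rels) (c : K) : Prop :=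
  v *r a = c *: (v : restr) :> restr.

Definition has_dim (n : nat) : Prop := inhabited (Vector.axiom n restr).

End RestrictionOfScalars.

Section QuantumWeylRelators.
Variables (K : fieldType) (q1 q2 lam : K).
Variables (F : algType K) (X1 Y1 X2 Y2 : F).

Definition qweyl_rels : seq F :=
  [:: X1 * X2 - (q1 * lam) *: (X2 * X1);
      X1 * Y2 - lam^-1 *: (Y2 * X1);
      Y1 * Y2 - lam *: (Y2 * Y1);
      Y1 * X2 - (q1^-1 * lam^-1) *: (X2 * Y1);
      (X1 * Y1 - q1 *: (Y1 * X1)) - 1;
      (X2 * Y2 - q2 *: (Y2 * X2)) - (1 + (q1 - 1) *: (Y1 * X1))].

Local Notation A := (palg qweyl_rels).

Lemma qweyl_relsP (x1 := \pi_A X1 : A) (y1 := \pi_A Y1 : A)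
    (x2 := \pi_A X2 : A) (y2 := \pi_A Y2 : A) :
  [/\ x1 * x2 = (q1 * lam) *: (x2 * x1),
      x1 * y2 = lam^-1 *: (y2 * x1),
      y1 * y2 = lam *: (y2 * y1),
      y1 * x2 = (q1^-1 * lam^-1) *: (x2 * y1)
    & x1 * y1 - q1 *: (y1 * x1) = 1 /\
      x2 * y2 - q2 *: (y2 * x2) = 1 + (q1 - 1) *: (y1 * x1)].
Proof.
have rel i : (i < 6)%N -> \pi_A (nth 0 qweyl_rels i) = 0.
  by move=> lt_i; apply: palg_gen; apply: mem_nth.
have piE := (@palg_piD K F qweyl_rels, @palg_piN K F qweyl_rels,
  @palg_piZ K F qweyl_rels, @palg_piM K F qweyl_rels, @palg_pi1 K F qweyl_rels).
split; [| | | |split]; apply/subr0_eq.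
- by have := rel 0 isT; rewrite [nth _ _ _]/= !piE.
- by have := rel 1 isT; rewrite [nth _ _ _]/= !piE.
- by have := rel 2 isT; rewrite [nth _ _ _]/= !piE.
- by have := rel 3 isT; rewrite [nth _ _ _]/= !piE.
- by have := rel 4 isT; rewrite [nth _ _ _]/= !piE.
- by have := rel 5 isT; rewrite [nth _ _ _]/= !piE.
Qed.

End QuantumWeylRelators.

Section QuantumWeyl.
Variables (K : fieldType) (q1 q2 lam : K).

Local Notation X1 := (fvar K (@inord 3 0)).
Local Notation Y1 := (fvar K (@inord 3 1)).
Local Notation X2 := (fvar K (@inord 3 2)).
Local Notation Y2 := (fvar K (@inord 3 3)).

Definition qweyl_relators : seq (freealg K 4) :=
  qweyl_rels q1 q2 lam X1 Y1 X2 Y2.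

Local Notation A := (palg qweyl_relators).

Definition x1 : A := \pi_A X1.
Definition y1 : A := \pi_A Y1.
Definition x2 : A := \pi_A X2.
Definition y2 : A := \pi_A Y2.
Definition z1 : A := x1 * y1 - y1 * x1.
Definition z2 : A := x2 * y2 - y2 * x2.

End QuantumWeyl.

Arguments x1 {K q1 q2 lam}.
Arguments y1 {K q1 q2 lam}.
Arguments x2 {K q1 q2 lam}.
Arguments y2 {K q1 q2 lam}.
Arguments z1 {K q1 q2 lam}.
Arguments z2 {K q1 q2 lam}.

Notation qweyl q1 q2 lam := (palg (qweyl_relators q1 q2 lam)).

Definition type_M5 (K : fieldType) (q1 q2 lam : K) (l1 : nat)
    (alpha xi gamma : K) (M : rmod (qweyl q1 q2 lam)) : Prop :=
  [/\ [/\ alpha != 0, xi != 0 & gamma != 0],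
      simple_rmod M,
      bijective (fun m : M => m *r z1),
      (forall m : M, m *r z2 = 0)
    & exists (v : M) (beta : K),
        [/\ v != 0,
            eigen v (x1 ^+ l1) alpha,
            eigen v (y1 ^+ l1) beta,
            eigen v x2 xi
          & eigen v z1 gamma]].

(* Main.v *)
Require Import Defs.
From HB Require Import structures.
From mathcomp Require Import all_boot all_order all_algebra.
From mathcomp Require Import generic_quotient boolp.

Set Implicit Arguments.
Unset Strict Implicit.
Unset Printing Implicit Defensive.

Import GRing.Theory.
Local Open Scope ring_scope.

(* Let v be the given eigenvector of M.  Since x1 skew-commutes with x2 and z1,
   the vectors v x1^j with j < l1 are eigenvectors of x2 and z1, with
   eigenvalues (q1 lam)^j xi and q1^j gamma; they are nonzero because alpha is,
   and independent because the eigenvalues of z1 are distinct.  Both y1 x1 and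
   y2 x2 are affine in z1 on M (as z2 = 0), so y1 and y2 also map each v x1^j to
   a multiple of some v x1^k.  The span is thus a submodule, hence M, and A acts
   on it by matrices depending only on (alpha, xi, gamma).  Replacing v by v x1^r
   shifts the parameters by r, and an isomorphism sends v to an eigenvector of
   the other module, whose parameters can be read off on any nonzero coordinate. *)

(** * Right modules as right actions by K-linear operators *)

Section Representations.
Variables (K : fieldType) (F : algType K) (rels : seq F).
Local Notation A := (palg rels).

(** Operators on a plain K-space keep the coordinate computations K-linear and let one statement
    range over all modules at once. *)
Definition right_action (V : lmodType K) (act : A -> {linear V -> V}) : Prop :=
  [/\ forall m, act 1 m = m, forall a b m, act (a * b) m = act b (act a m),
      forall a b m, act (a + b) m = act a m + act b m
    & forall c a m, act (c *: a) m = c *: act a m].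

Variable M : rmod A.

Definition restr_act_fun (a : A) (m : restr M) : restr M := (m : M) *r a.

Lemma restr_act_funZ c a m : restr_act_fun (c *: a) m = c *: restr_act_fun a m.
Proof. by rewrite /restr_act_fun -[a in LHS]mulr1 palg_scalerAr ractM. Qed.

Lemma restr_act_fun_linear a : linear (restr_act_fun a).
Proof.
move=> c m m'; rewrite /restr_act_fun ractDl; congr (_ + _).
rewrite -[RHS]restr_act_funZ.
change (((m : M) *r (c *: (1 : A))) *r a = (m : M) *r (c *: a)).
by rewrite -ractM -palg_scalerAl mul1r.
Qed.

HB.instance Definition _ a := GRing.isLinear.Build K (restr M) (restr M) *:%R
  (restr_act_fun a) (restr_act_fun_linear a).

Definition restr_act (a : A) : {linear restr M -> restr M} := restr_act_fun a.

Lemma restr_actP : right_action restr_act.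
Proof.
split=> [m|a b m|a b m|c a m].
- exact: ract1.
- exact: ractM.
- exact: ractDr.
- exact: restr_act_funZ.
Qed.

End Representations.

(** * Consequences of the defining relations *)

Section QuantumWeylModules.
Variables (K : fieldType) (q1 q2 lam : K).
Local Notation A := (qweyl q1 q2 lam).
Hypotheses (q1_neq1 : q1 != 1) (q2_neq1 : q2 != 1).

(** Words grow on the left because in a right action the leftmost letter acts first: one generator
    moves the orbit vectors, then the induction hypothesis takes over. *)
Lemma qweyl_ind (P : A -> Prop) :
  P 1 -> (forall a b, P a -> P b -> P (a + b)) ->
  (forall c a, P a -> P (c *: a)) ->
  (forall a, P a -> [/\ P (x1 * a), P (y1 * a), P (x2 * a) & P (y2 * a)]) ->
  forall a, P a.
Proof.
move=> P1 PD PZ PM; elim/quotW.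
elim/freealg_ind => [|f g Pf Pg|c f Pf|i f Pf].
- by rewrite palg_pi1.
- by rewrite palg_piD; exact: PD.
- by rewrite palg_piZ; exact: PZ.
have [Px1 Py1 Px2 Py2] := PM _ Pf.
rewrite palg_piM -[i]inord_val; case: i => [[|[|[|[|//]]]] /= _].
- exact: Px1.
- exact: Py1.
- exact: Px2.
- exact: Py2.
Qed.

Let qweyl_relsA := qweyl_relsP q1 q2 lam (fvar K (@inord 3 0))
  (fvar K (@inord 3 1)) (fvar K (@inord 3 2)) (fvar K (@inord 3 3)).

Lemma x1_x2 : x1 * x2 = (q1 * lam) *: (x2 * x1) :> A.
Proof. by have [] := qweyl_relsA. Qed.

Lemma x1_y1 : x1 * y1 = 1 + q1 *: (y1 * x1) :> A.
Proof. have [_ _ _ _ [<- _]] := qweyl_relsA. by rewrite subrK. Qed.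

Lemma z1E : z1 = 1 + (q1 - 1) *: (y1 * x1) :> A.
Proof. by rewrite /z1 x1_y1 scalerBl scale1r addrA. Qed.

Lemma z2E : z2 = z1 + (q2 - 1) *: (y2 * x2) :> A.
Proof.
have [_ _ _ _ [_ e]] := qweyl_relsA.
have -> : z1 = x2 * y2 - q2 *: (y2 * x2) :> A by rewrite z1E; exact/esym.
by rewrite /z2 scalerBl scale1r addrA subrK.
Qed.

(** After substituting [z1E], both sides reduce to q1 x1 + q1 (q1 - 1) y1 x1^2. *)
Lemma x1_z1 : x1 * z1 = q1 *: (z1 * x1) :> A.
Proof.
rewrite z1E mulrDr mulrDl mulr1 mul1r -palg_scalerAr -palg_scalerAl mulrA x1_y1.
rewrite mulrDl mul1r scalerDr addrA -palg_scalerAl scalerBl scale1r.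
by rewrite [x1 + _]addrC subrK scalerDr !scalerA [q1 * _]mulrC.
Qed.

(** This makes y1 undo one factor x1 on an eigenvector of z1, up to a scalar. *)
Lemma x1_y1_z1 : x1 * y1 = (q1 - 1)^-1 *: (q1 *: z1 - 1) :> A.
Proof.
have q1B1 : q1 - 1 != 0 by rewrite subr_eq0.
apply: (scalerI q1B1); rewrite scalerA divff // scale1r x1_y1 z1E.
move: (y1 * x1) (1 : A) => w u.
by rewrite !scalerDr scalerBl scale1r addrAC !scalerA [q1 * _]mulrC.
Qed.

Lemma x2_y2_z : x2 * y2 = z2 + (q2 - 1)^-1 *: (z2 - z1) :> A.
Proof.
have q2B1 : q2 - 1 != 0 by rewrite subr_eq0.
have -> : z2 - z1 = (q2 - 1) *: (y2 * x2) :> A by rewrite z2E [z1 + _]addrC addrK.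
rewrite scalerA mulVf // scale1r /z2.
by move: (x2 * y2) (y2 * x2) => u w; rewrite subrK.
Qed.

End QuantumWeylModules.

Lemma exp_skew_commute (K : fieldType) (F : algType K) (rels : seq F)
    (a x : palg rels) (c : K) (j : nat) :
  x * a = c *: (a * x) -> x ^+ j * a = c ^+ j *: (a * x ^+ j).
Proof.
move=> xa; elim: j => [|j IHj]; first by rewrite !expr0 scale1r mul1r mulr1.
rewrite [in LHS]exprS -mulrA IHj -palg_scalerAr mulrA xa -palg_scalerAl.
by rewrite scalerA -exprSr -mulrA -exprS.
Qed.

(** * Linear combinations of the vectors v x1^j *)

Section Orbit.
Variables (K : fieldType) (q1 q2 lam : K) (l1 : nat).
Local Notation A := (qweyl q1 q2 lam).
Variables (V : lmodType K) (act : A -> {linear V -> V}) (v : V).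

Definition orbit_map (c : 'rV[K]_l1) : V :=
  \sum_j c 0 j *: act (x1 ^+ j) v.

Lemma orbit_map_is_linear : linear orbit_map.
Proof.
move=> a c d; rewrite /orbit_map scaler_sumr -big_split /=.
by apply: eq_bigr => j _; rewrite !mxE scalerDl scalerA.
Qed.

HB.instance Definition _ :=
  GRing.isLinear.Build K 'rV[K]_l1 V *:%R orbit_map orbit_map_is_linear.

Lemma orbit_map_delta (j : 'I_l1) :
  orbit_map (delta_mx 0 j) = act (x1 ^+ j) v.
Proof.
rewrite /orbit_map (bigD1 j) //= mxE !eqxx scale1r big1 ?addr0 // => i ij.
by rewrite mxE (negPf ij) andbF scale0r.
Qed.

Lemma act_orbit_map_diag (a : A) (mu : nat -> K) c :
  (forall j, act a (act (x1 ^+ j) v) = mu j *: act (x1 ^+ j) v) ->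
  act a (orbit_map c) = orbit_map (\row_j (c 0 j * mu j)).
Proof.
move=> av; rewrite /orbit_map linear_sum; apply: eq_bigr => j _.
by rewrite linearZ /= av scalerA mxE.
Qed.

End Orbit.

(** * Action of the algebra on the orbit of an eigenvector *)

Section EigenvectorOrbits.
Variables (K : fieldType) (q1 q2 lam : K) (l1 : nat).
Local Notation A := (qweyl q1 q2 lam).
Hypotheses (q1_neq0 : q1 != 0) (q1_neq1 : q1 != 1) (q2_neq1 : q2 != 1).
Hypotheses (lam_neq0 : lam != 0) (q1_prim : l1.-primitive_root q1).
Variables (alpha xi gamma : K).
Hypotheses (alpha_neq0 : alpha != 0) (xi_neq0 : xi != 0) (gamma_neq0 : gamma != 0).

Let l1_gt0 : (0 < l1)%N := prim_order_gt0 q1_prim.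

(** Zero vectors are allowed, so the condition passes freely to shifts v x1^r and to linear
    images. *)
Definition M5_vector (V : lmodType K) (act : A -> {linear V -> V}) (v : V) : Prop :=
  [/\ forall m, act z2 m = 0, act (x1 ^+ l1) v = alpha *: v,
      act x2 v = xi *: v & act z1 v = gamma *: v].

Section OneVector.
Variables (V : lmodType K) (act : A -> {linear V -> V}) (v : V).
Hypotheses (actP : right_action act) (Mv : M5_vector act v).

Let act1 m : act 1 m = m. Proof. by case: actP. Qed.
Let actM a b m : act (a * b) m = act b (act a m). Proof. by case: actP. Qed.
Let actD a b m : act (a + b) m = act a m + act b m. Proof. by case: actP. Qed.
Let actZ c a m : act (c *: a) m = c *: act a m. Proof. by case: actP. Qed.
Let actB a b m : act (a - b) m = act a m - act b m.
Proof. by rewrite -[- b]scaleN1r actD actZ scaleN1r. Qed.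

Lemma orbit_x1 j : act x1 (act (x1 ^+ j) v) = act (x1 ^+ j.+1) v.
Proof. by rewrite exprSr actM. Qed.

Lemma orbit_l1 j : act (x1 ^+ (l1 + j)) v = alpha *: act (x1 ^+ j) v.
Proof. by have [_ al _ _] := Mv; rewrite exprD actM al linearZ. Qed.

Lemma orbit_muln k j :
  act (x1 ^+ (k * l1 + j)) v = alpha ^+ k *: act (x1 ^+ j) v.
Proof.
elim: k => [|k IHk]; first by rewrite scale1r.
by rewrite mulSn -addnA orbit_l1 IHk scalerA -exprS.
Qed.

Lemma orbit_x2 j :
  act x2 (act (x1 ^+ j) v) = ((q1 * lam) ^+ j * xi) *: act (x1 ^+ j) v.
Proof.
have [_ _ ax2 _] := Mv.
rewrite -actM (exp_skew_commute j (x1_x2 q1 q2 lam)) actZ actM ax2.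
by rewrite linearZ scalerA.
Qed.

Lemma orbit_z1 j :
  act z1 (act (x1 ^+ j) v) = (q1 ^+ j * gamma) *: act (x1 ^+ j) v.
Proof.
have [_ _ _ az1] := Mv.
rewrite -actM (exp_skew_commute j (x1_z1 q1 q2 lam)) actZ actM az1.
by rewrite linearZ scalerA.
Qed.

Lemma orbit_y1S j :
  act y1 (act (x1 ^+ j.+1) v) =
    ((q1 - 1)^-1 * (q1 * (q1 ^+ j * gamma) - 1)) *: act (x1 ^+ j) v.
Proof.
rewrite -orbit_x1 -actM x1_y1_z1 // actZ actB actZ orbit_z1 act1 scalerA.
by rewrite -{2}[act _ v]scale1r -scalerBl scalerA.
Qed.

(* On these vectors x2 is a nonzero scalar and x2 y2, as z2 = 0, a multiple of z1. *)
Lemma orbit_y2 j :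
  act y2 (act (x1 ^+ j) v) =
    - (((q1 * lam) ^+ j * xi)^-1 * (q2 - 1)^-1 * (q1 ^+ j * gamma))
      *: act (x1 ^+ j) v.
Proof.
have c_neq0 : (q1 * lam) ^+ j * xi != 0 by rewrite mulf_neq0 ?expf_neq0 ?mulf_neq0.
have [z20 _ _ _] := Mv.
apply: (scalerI c_neq0); rewrite -linearZ -orbit_x2 -[act y2 _]actM.
rewrite x2_y2_z // actD actZ z20.
rewrite [act (z2 - z1) _]actB z20 add0r sub0r
  orbit_z1 -scaleNr !scalerA mulrN !mulrN !mulrA mulfV //.
by rewrite mul1r.
Qed.

(** If v x1^j vanished, so would v x1^l1 = alpha v. *)
Lemma orbit_neq0 j : v != 0 -> (j <= l1)%N -> act (x1 ^+ j) v != 0.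
Proof.
move=> v_neq0 le_j; apply: contraNneq v_neq0 => ej0.
have := orbit_l1 0; rewrite addn0 -(subnKC le_j) exprD actM ej0 linear0 expr0 act1.
by move/esym/eqP; rewrite scaler_eq0 (negPf alpha_neq0).
Qed.

(* Each operator z1 - mu k kills the k-th term; all but one are killed in turn. *)
Lemma orbit_map_inj : v != 0 -> injective (orbit_map (l1 := l1) act v).
Proof.
move=> v_neq0; apply: raddf_inj => c c0.
pose mu j := q1 ^+ j * gamma.
have kill (s : seq 'I_l1) :
    orbit_map act v (\row_j (c 0 j * \prod_(k <- s) (mu j - mu k))) = 0.
  elim: s => [|k s IHs].
    rewrite -[RHS]c0; congr orbit_map; apply/rowP => j.
    by rewrite mxE big_nil mulr1.
  have := act_orbit_map_diag (\row_j (c 0 j * \prod_(k <- s) (mu j - mu k))) orbit_z1.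
  (* Writing the 0 of [mu k *: 0] back as the image of the previous row turns the equation into the
     action of z1 - mu k. *)
  rewrite IHs linear0 => /esym/(congr1 (fun m => m - mu k *: 0)).
  rewrite -{1}IHs -linearZ -linearB scaler0 subr0 => <-.
  congr orbit_map; apply/rowP => j; rewrite !mxE big_cons -/(mu j).
  by rewrite mulrBl mulrBr !(mulrCA (c 0 j)) [_ * mu j]mulrC.
apply/rowP => i; rewrite mxE.
have := kill [seq k <- enum 'I_l1 | k != i].
rewrite /orbit_map (bigD1 i) //= big1 ?addr0 => [|k k_neq]; last first.
  rewrite mxE big_filter big_enum_cond /= (bigD1 k) //= subrr mul0r mulr0.
  by rewrite scale0r.
move/eqP; rewrite scaler_eq0 (negPf (orbit_neq0 v_neq0 (ltnW (ltn_ord i)))) orbF.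
rewrite mxE mulf_eq0 => /orP[/eqP //|]; rewrite big_filter big_enum_cond /=.
rewrite prodf_seq_eq0 => /hasP[k _ /andP[k_neq]].
rewrite subr_eq0 (inj_eq (mulIf gamma_neq0)) (eq_prim_root_expr q1_prim).
by rewrite !modn_small // => /eqP/val_inj e; rewrite e eqxx in k_neq.
Qed.

End OneVector.

(** [R] is chosen before the space, the action and the vector; hence modules with the same
    parameters share it. *)
Definition uniform_matrix (a : A) : Prop :=
  exists R : 'M[K]_l1, forall (V : lmodType K) (act : A -> {linear V -> V}) (v : V),
    right_action act -> M5_vector act v ->
    forall c, act a (orbit_map act v c) = orbit_map act v (c *m R).

Lemma uniform_matrix_monomial (a : A) :
  (forall j, exists cn : K * nat, forall (V : lmodType K)
    (act : A -> {linear V -> V}) (v : V),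
    right_action act -> M5_vector act v ->
     act a (act (x1 ^+ j) v) = cn.1 *: act (x1 ^+ cn.2) v) ->
  uniform_matrix a.
Proof.
move=> amono.
have arow (j : 'I_l1) : exists w : 'rV[K]_l1, forall (V : lmodType K)
    (act : A -> {linear V -> V}) (v : V), right_action act ->
    M5_vector act v -> act a (act (x1 ^+ j) v) = orbit_map act v w.
  have [[c n] /= an] := amono j.
  (* The exponent n may reach l1 or more: it is reduced modulo l1, each full turn contributing a
     factor alpha. *)
  exists (c *: (alpha ^+ (n %/ l1) *: delta_mx 0 (Ordinal (ltn_pmod n l1_gt0)))).
  move=> V act v actP Mv; rewrite an // !linearZ /= orbit_map_delta.
  by rewrite {1}(divn_eq n l1) (orbit_muln actP Mv).
have [w aw] := fin_all_exists arow.
exists (\matrix_j w j) => V act v actP Mv c; rewrite mulmx_sum_row [RHS]raddf_sum.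
rewrite {1}/orbit_map raddf_sum; apply: eq_bigr => j _.
by rewrite /= rowK !linearZ /= aw.
Qed.

Lemma uniform_matrixP (a : A) : uniform_matrix a.
Proof.
elim/qweyl_ind: a => [|a b [R aR] [S bS]|c a [R aR]|a [R aR]].
- by exists 1%:M => V act v [act1 _ _ _] _ c; rewrite act1 mulmx1.
- exists (R + S) => V act v actP Mv c.
  have [_ _ actD _] := actP.
  by rewrite actD (aR _ _ _ actP Mv) (bS _ _ _ actP Mv) mulmxDr
    linearD.
- exists (c *: R) => V act v actP Mv d.
  have [_ _ _ actZ] := actP.
  by rewrite actZ (aR _ _ _ actP Mv) -scalemxAr linearZ.
have mulR g : uniform_matrix g -> uniform_matrix (g * a).
  move=> [S gS]; exists (S *m R) => V act v actP Mv c.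
  have [_ actM _ _] := actP.
  by rewrite actM (gS _ _ _ actP Mv) (aR _ _ _ actP Mv) mulmxA.
split; apply: mulR; apply: uniform_matrix_monomial => j.
- by exists (1, j.+1) => V act v actP Mv; rewrite scale1r (orbit_x1 _ actP).
(* For j = 0 there is no exponent to lower, so v x1^j is replaced by alpha^-1 v x1^(l1 + j) before
   y1 acts. *)
- exists (alpha^-1 * ((q1 - 1)^-1 * (q1 * (q1 ^+ (l1 + j).-1 * gamma) - 1)),
    (l1 + j).-1) => V act v actP Mv /=.
  rewrite -scalerA -(orbit_y1S actP Mv) prednK ?addn_gt0 ?l1_gt0 //.
  by rewrite (orbit_l1 actP Mv) linearZ scalerA mulVf // scale1r.
- by exists ((q1 * lam) ^+ j * xi, j) => V act v actP Mv; rewrite (orbit_x2 actP Mv).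
- by eexists (_, j) => V act v actP Mv; rewrite (orbit_y2 actP Mv).
Qed.

End EigenvectorOrbits.

(** * Coordinates on a simple module *)

Section SimpleModules.
Variables (K : fieldType) (q1 q2 lam : K) (l1 : nat).
Local Notation A := (qweyl q1 q2 lam).
Hypotheses (q1_neq0 : q1 != 0) (q1_neq1 : q1 != 1) (q2_neq1 : q2 != 1).
Hypotheses (lam_neq0 : lam != 0) (q1_prim : l1.-primitive_root q1).
Variables (alpha xi gamma : K).

Lemma type_M5_vector (M : rmod A) : type_M5 l1 alpha xi gamma M ->
  exists2 v : restr M, v != 0 & M5_vector l1 alpha xi gamma (restr_act M) v.
Proof.
move=> [_ _ _ z20 [v [_ [v_neq0 va _ vx2 vz1]]]].
exists v; first exact: v_neq0.
by split; [exact: z20 | exact: va | exact: vx2 | exact: vz1].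
Qed.

Hypotheses (alpha_neq0 : alpha != 0) (xi_neq0 : xi != 0).
Hypothesis gamma_neq0 : gamma != 0.

Let uniform := uniform_matrixP q1_neq0 q1_neq1 q2_neq1 lam_neq0 q1_prim
  gamma alpha_neq0 xi_neq0.

(** The image is stable under A by the uniform matrices and contains v, so simplicity makes it all
    of M; injectivity comes from the distinct eigenvalues of z1. *)
Lemma orbit_map_bij (M : rmod A) (v : restr M) :
  simple_rmod M -> M5_vector l1 alpha xi gamma (restr_act M) v -> v != 0 ->
  bijective (orbit_map (l1 := l1) (restr_act M) v).
Proof.
move=> [_ Msimple] Mv v_neq0.
have actP := restr_actP M.
have phi_inj : injective (orbit_map (l1 := l1) (restr_act M) v).
  exact: (orbit_map_inj q1_prim alpha_neq0 gamma_neq0 actP Mv v_neq0).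
pose S : {pred M} := fun m => `[< exists c, m = orbit_map (l1 := l1) (restr_act M) v c >].
have S_closed : submod_closed S.
  split=> [|a m m' /asboolP[c ->] /asboolP[c' ->]]; apply/asboolP.
    by exists 0; rewrite linear0.
  have [R aR] := uniform (a : A).
  exists (c *m R + c'); rewrite linearD /= -(aR _ _ _ actP Mv).
  by [].
have l1_gt0 : (0 < l1)%N := prim_order_gt0 q1_prim.
have Sv : (v : M) \in S.
  apply/asboolP; exists (delta_mx 0 (Ordinal l1_gt0)).
  by rewrite orbit_map_delta; have [-> _ _ _] := actP.
have surj m : exists c, m = orbit_map (l1 := l1) (restr_act M) v c.
  suff /asboolP : (m : M) \in S by [].
  have [S0|ST] := Msimple S S_closed; last by rewrite ST.
  by have := S0 v; rewrite Sv inE (negPf v_neq0).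
have [g gE] := choice surj.
by exists g => [c|m]; [apply: phi_inj; exact: esym (gE _) | exact: esym (gE m)].
Qed.

Lemma type_M5_has_dim (M : rmod A) : type_M5 l1 alpha xi gamma M -> has_dim M l1.
Proof.
move=> MM; have [v v_neq0 Mv] := type_M5_vector MM.
have [_ Msimple _ _ _] := MM.
have [g gK Kg] := orbit_map_bij Msimple Mv v_neq0.
split; exists g; first exact: (can2_linear gK Kg).
by exists (orbit_map (restr_act M) v).
Qed.

(* Both modules are coordinatized by l1-rows on which A acts by the same matrices. *)
Lemma simple_M5_iso (M M' : rmod A) (v : restr M) (v' : restr M') :
  simple_rmod M -> simple_rmod M' ->
  M5_vector l1 alpha xi gamma (restr_act M) v -> v != 0 ->
  M5_vector l1 alpha xi gamma (restr_act M') v' -> v' != 0 -> rmod_iso M M'.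
Proof.
move=> Ms Ms' Mv v0 Mv' v0'.
have [g gK Kg] := orbit_map_bij Ms Mv v0.
have [g' gK' Kg'] := orbit_map_bij Ms' Mv' v0'.
pose f (m : M) : M' := orbit_map (restr_act M') v' (g m).
have f_lin : linear f.
  move=> a m m'; rewrite /f.
  have [R aR] := uniform (a : A).
  have -> : g (a *: m + m') = g m *m R + g m'.
    apply: (can_inj gK); rewrite Kg linearD /= -(aR _ _ _ (restr_actP M) Mv) !Kg.
    by [].
  rewrite linearD /= -(aR _ _ _ (restr_actP M') Mv').
  by [].
pose flin := GRing.isLinear.Build A^c M M' *:%R f f_lin.
pose F : {linear M -> M'} := HB.pack f flin.
exists F; exists (fun m' : M' => orbit_map (restr_act M) v (g' m') : M) => m.
  by rewrite /F /= /f gK' Kg.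
by rewrite /F /= /f gK Kg'.
Qed.

End SimpleModules.

(** * Comparison of parameters under isomorphism *)

Section Isomorphisms.
Variables (K : fieldType) (q1 q2 lam : K) (l1 : nat).
Local Notation A := (qweyl q1 q2 lam).

Lemma M5_vector_shift (V : lmodType K) (act : A -> {linear V -> V}) (v : V)
    (alpha xi gamma : K) (r : nat) :
  right_action act -> M5_vector l1 alpha xi gamma act v ->
  M5_vector l1 alpha ((q1 * lam) ^+ r * xi) (q1 ^+ r * gamma) act (act (x1 ^+ r) v).
Proof.
move=> actP Mv; have [z20 _ _ _] := Mv; have [_ actM _ _] := actP.
split=> //; [|exact: (orbit_x2 actP Mv)|exact: (orbit_z1 actP Mv)].
by rewrite -actM -exprD addnC (orbit_l1 actP Mv).
Qed.

(** x1^l1, x2 and z1 are diagonal on the orbit of v, so an eigenvector u has, at any nonzero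
    coordinate j, the eigenvalues of v x1^j. *)
Lemma M5_eigenvalues (V : lmodType K) (act : A -> {linear V -> V}) (v u : V)
    (alpha xi gamma alpha' xi' gamma' : K) :
  l1.-primitive_root q1 -> alpha' != 0 -> gamma' != 0 -> right_action act ->
  v != 0 -> M5_vector l1 alpha' xi' gamma' act v ->
  u != 0 -> M5_vector l1 alpha xi gamma act u ->
  (exists c, u = orbit_map (l1 := l1) act v c) ->
  exists r : nat, [/\ (r <= l1 - 1)%N, alpha = alpha',
                      xi = (q1 * lam) ^+ r * xi' & gamma = q1 ^+ r * gamma'].
Proof.
move=> q1_prim alpha'_neq0 gamma'_neq0 actP v_neq0 Mv u_neq0 [_ al ax2 az1] [c uE].
have phi_inj := orbit_map_inj q1_prim alpha'_neq0 gamma'_neq0 actP Mv v_neq0.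
have [j cj_neq0] : exists j, c 0 j != 0.
  apply/existsP; apply: contraNT u_neq0 => /existsPn c0; rewrite uE.
  suff -> : c = 0 by rewrite linear0.
  by apply/rowP => j; rewrite mxE; apply/eqP; rewrite -[_ == _]negbK.
(* The same j serves all three operators, which gives a single r for both xi and gamma. *)
have eig a mu e : act a u = e *: u ->
    (forall k, act a (act (x1 ^+ k) v) = mu k *: act (x1 ^+ k) v) -> e = mu j.
  move=> au amu; move: au; rewrite uE (act_orbit_map_diag _ amu) -linearZ.
  move=> /phi_inj/rowP/(_ j); rewrite !mxE mulrC => /esym.
  exact: (mulIf cj_neq0).
exists j; split.
- by rewrite subn1 -ltnS prednK // (leq_ltn_trans _ (ltn_ord j)).
- apply: (eig _ (fun _ => alpha') _ al) => k; have [_ actM _ _] := actP.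
  by rewrite -actM -exprD addnC (orbit_l1 actP Mv).
- exact: (eig _ _ _ ax2 (orbit_x2 actP Mv)).
- exact: (eig _ _ _ az1 (orbit_z1 actP Mv)).
Qed.

Lemma M5_vector_linear (M M' : rmod A) (f : {linear M -> M'}) (v : restr M)
    (alpha xi gamma : K) :
  (forall m' : M', m' *r z2 = 0) -> M5_vector l1 alpha xi gamma (restr_act M) v ->
  M5_vector l1 alpha xi gamma (restr_act M') (f v : restr M').
Proof.
have fZ a c (m : restr M) : restr_act M a m = c *: m ->
    restr_act M' a (f m : restr M') = c *: (f m : restr M').
  (* A scalar c acts on both restrictions as the element c *: 1 of A, so A-linearity of [f] also
     gives K-linearity. *)
  move=> am; change ((a : A^c) *: (f m : M') = ((c *: (1 : A)) : A^c) *: (f m : M')).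
  by rewrite -!linearZ; congr (f _); exact: am.
move=> z20 [_ al ax2 az1].
by split; [exact: z20 | exact: fZ al | exact: fZ ax2 | exact: fZ az1].
Qed.

End Isomorphisms.

Theorem theorem4p6 (K : closedFieldType) (q1 q2 lam : K) (l1 l2 : nat)
    (q1_neq0 : q1 != 0) (q1_neq1 : q1 != 1)
    (q2_neq0 : q2 != 0) (q2_neq1 : q2 != 1) (lam_neq0 : lam != 0)
    (q1_prim : l1.-primitive_root q1) (q2_prim : l2.-primitive_root q2)
    (lam_l1 : lam ^+ l1 = 1)
    (alpha xi gamma alpha' xi' gamma' : K)
    (alpha_neq0 : alpha != 0) (xi_neq0 : xi != 0) (gamma_neq0 : gamma != 0)
    (alpha'_neq0 : alpha' != 0) (xi'_neq0 : xi' != 0)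
    (gamma'_neq0 : gamma' != 0) :
  (forall M : rmod (qweyl q1 q2 lam), type_M5 l1 alpha xi gamma M -> has_dim M l1) /\
  (forall M M' : rmod (qweyl q1 q2 lam),
     type_M5 l1 alpha xi gamma M -> type_M5 l1 alpha' xi' gamma' M' ->
     rmod_iso M M' <->
     (exists r : nat, [/\ (r <= l1 - 1)%N, alpha = alpha',
                          xi = (q1 * lam) ^+ r * xi'
                        & gamma = q1 ^+ r * gamma'])).
Proof.
split=> [M|M M' MM MM']; first exact: type_M5_has_dim.
have [v v_neq0 Mv] := type_M5_vector MM.
have [v' v'_neq0 Mv'] := type_M5_vector MM'.
have [_ Ms _ _ _] := MM; have [_ Ms' _ z20 _] := MM'.
have actP' := restr_actP M'.
split=> [[f f_bij]|[r [le_r ea exi eg]]].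
  (* Forward direction: f v has the parameters of M, and its coordinates along the orbit of v'
     reveal r. *)
  have fv_neq0 : (f v : restr M') != 0.
    by apply: contraNneq v_neq0 => fv0; apply/eqP/(bij_inj f_bij); rewrite fv0 linear0.
  apply: (M5_eigenvalues q1_prim alpha'_neq0 gamma'_neq0 actP' v'_neq0 Mv' fv_neq0).
    exact: M5_vector_linear.
  have [g _ Kg] := orbit_map_bij q1_neq0 q1_neq1 q2_neq1 lam_neq0 q1_prim
    alpha'_neq0 xi'_neq0 gamma'_neq0 Ms' Mv' v'_neq0.
  by exists (g (f v)); rewrite Kg.
(* Conversely, v' x1^r has exactly the parameters of v, which reduces the claim to equal
   parameters. *)
have := M5_vector_shift r actP' Mv'; rewrite -exi -eg -ea => Mr.
apply: (simple_M5_iso _ _ _ _ q1_prim _ _ _ Ms Ms' Mv v_neq0 Mr) => //.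
apply: (orbit_neq0 alpha'_neq0 actP' Mv' v'_neq0).
by rewrite (leq_trans le_r) // leq_subr.
Qed.
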